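(* For all integers $m,n\geq 5$, $s_3^u(P_m\square P_n)=mn$.
   Context: $P_m$ is the path on $m$ vertices. The Cartesian product $G_1\square G_2$ has vertex set $V(G_1)\times V(G_2)$, with $(u,v)$ and $(u',v')$ adjacent iff ($u=u'$ and $vv'\in E(G_2)$) or ($v=v'$ and $uu'\in E(G_1)$). All graphs are finite, simple and connected. $\Delta(G)$ is the maximum degree of $G=(V,E)$; $N[x]$ is the closed neighborhood of $x$ and $N[X]=\bigcup_{x\in X}N[x]$. For nonempty $S\subseteq V$: $Bord(S)=\{x\in S: N[x]-S\neq\emptyset\}$ and $\partial S=N[S]-S$. For a nonempty proper subset $S$ of $V$: an attack on $S$ is a function $A:\partial S\to Bord(S)$ such that each $x\in\partial S$ is adjacent to $A(x)$; a defense of $S$ is a function $D:N[Bord(S)]\cap S\to Bord(S)$ such that for each $y$ in the domain, $D(y)=y$ or $D(y)$ is adjacent to $y$. For $0\le k<\Delta(G)$, a defense $D$ of $S$ is an ultra $k$-defense if for every attack $A$ on $S$, $|D^{-1}(x)|-|A^{-1}(x)|\geq k$ for all $x\in Bord(S)$. A nonempty set $S\subseteq V$ is an ultra $k$-secure set if $S=V$ or $S$ has an ultra $k$-defense. The ultra $k$-security number $s_k^u(G)$ is the minimum cardinality of an ultra $k$-secure set in $G$. *)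

(* Defs.v *)
From mathcomp Require Import all_boot.
Set Implicit Arguments.
Unset Strict Implicit.
Unset Printing Implicit Defensive.

Record sgraph := SGraph {
  vertex :> finType;
  adj : rel vertex;
  adj_sym : symmetric adj;
  adj_irrefl : irreflexive adj
}.

Definition path_adj (m : nat) : rel 'I_m :=
  fun i j => (i.+1 == j :> nat) || (j.+1 == i :> nat).

Lemma path_adj_sym m : symmetric (@path_adj m).
Proof. by move=> i j; rewrite /path_adj orbC. Qed.

Lemma path_adj_irrefl m : irreflexive (@path_adj m).
Proof. by move=> i; rewrite /path_adj orbb gtn_eqF. Qed.

Definition path_graph (m : nat) : sgraph :=
  SGraph (@path_adj_sym m) (@path_adj_irrefl m).

Section CartesianProduct.
Variables G1 G2 : sgraph.

Definition cart_adj : rel (G1 * G2)%type :=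
  fun p q => ((p.1 == q.1) && adj p.2 q.2) || ((p.2 == q.2) && adj p.1 q.1).

Lemma cart_adj_sym : symmetric cart_adj.
Proof.
move=> p q; rewrite /cart_adj (eq_sym p.1) (eq_sym p.2).
by rewrite (adj_sym p.1) (adj_sym p.2).
Qed.

Lemma cart_adj_irrefl : irreflexive cart_adj.
Proof. by move=> p; rewrite /cart_adj !adj_irrefl !andbF. Qed.

Definition cart_prod : sgraph := SGraph cart_adj_sym cart_adj_irrefl.

End CartesianProduct.

Section Security.
Variable G : sgraph.
Implicit Types (x y : G) (S X : {set G}) (A D : {ffun G -> G}).

Definition max_degree : nat := \max_(x : G) #|[set y | adj x y]|.

Definition cl_nbh x : {set G} := [set y | (y == x) || adj x y].

Definition cl_nbhs X : {set G} := \bigcup_(x in X) cl_nbh x.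

Definition bord S : {set G} := [set x in S | cl_nbh x :\: S != set0].

Definition boundary S : {set G} := cl_nbhs S :\: S.

(* Attacks on S (defined on [boundary S]) and defenses of S (defined on
   [def_dom S]) are represented by total functions on the vertices: only the
   values on the domain are constrained, and preimages are taken within the
   domain, so the values elsewhere are irrelevant. *)
Definition is_attack S A : bool :=
  [forall x in boundary S, (A x \in bord S) && adj x (A x)].

Definition def_dom S : {set G} := cl_nbhs (bord S) :&: S.

Definition is_defense S D : bool :=
  [forall y in def_dom S,
     (D y \in bord S) && ((D y == y) || adj y (D y))].

Definition attackers S A x : {set G} := [set y in boundary S | A y == x].

Definition defenders S D x : {set G} := [set y in def_dom S | D y == x].

(* |D^-1(x)| - |A^-1(x)| >= k, written additively because subtraction on
   [nat] is truncated. *)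
Definition is_ultra_defense k S D : bool :=
  is_defense S D &&
  [forall A, is_attack S A ==>
     [forall x in bord S, k + #|attackers S A x| <= #|defenders S D x|]].

Definition ultra_secure k S : bool :=
  (S != set0) &&
  ((S == [set: G]) || [exists D, is_ultra_defense k S D]).

(* The whole vertex set is ultra k-secure whenever G has a vertex
   ([ultra_secure_setT]), so it is a valid starting point for the minimum.
   The number is meaningful for k < max_degree. *)
Definition ultra_security_number k : nat :=
  #|[arg min_(S < [set: G] | ultra_secure k S) #|S|]|.

Lemma ultra_secure_setT k : 0 < #|G| -> ultra_secure k [set: G].
Proof. by rewrite /ultra_secure eqxx andbT -card_gt0 cardsT. Qed.

End Security.

Lemma grid_max_degree_gt3 m n : 5 <= m -> 5 <= n ->
  3 < max_degree (cart_prod (path_graph m) (path_graph n)).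
Proof.
case: m => // m; case: n => // n hm hn.
pose p (i j : nat) : cart_prod (path_graph m.+1) (path_graph n.+1) :=
  (inord i, inord j).
have e a i j : i < 5 -> j < 5 -> 5 <= a.+1 ->
    (inord i == inord j :> 'I_a.+1) = (i == j).
  by move=> hi hj ha; rewrite -val_eqE /= !inordK // ?(leq_trans hi) ?(leq_trans hj).
apply: leq_trans (leq_bigmax (p 1 1)).
have u : uniq [:: p 0 1; p 2 1; p 1 0; p 1 2].
  by rewrite /= !inE /p !xpair_eqE !e.
have -> : 4 = size [:: p 0 1; p 2 1; p 1 0; p 1 2] by [].
rewrite -(card_uniqP u); apply/subset_leq_card/subsetP => q.
have r a i : i < 5 -> 5 <= a.+1 -> (inord i : 'I_a.+1) = i :> nat.
  by move=> hi ha; rewrite inordK // (leq_trans hi).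
by rewrite !inE => /or4P[]/eqP ->;
  rewrite /adj /= /cart_adj /= /adj /= /path_adj !r // !eqxx ?orbT.
Qed.

(* Main.v *)
Require Import Defs.
From mathcomp Require Import all_boot.
Set Implicit Arguments.
Unset Strict Implicit.
Unset Printing Implicit Defensive.

(** The whole grid is ultra 3-secure, so the point is that no proper nonempty
    set [S] is.  An attack may send every outside neighbour of a border vertex
    [x] against [x] at once, while only members of [N[x]] inside [S] can
    defend [x].  In a graph of maximum degree at most [k + 1], an ultra
    [k]-defense [D] therefore satisfies
    [k + |N[x] - S| <= |D^-1(x)| <= |N[x] :&: S| <= k + 2 - |N[x] - S|],
    so [x] has exactly one neighbour outside [S], and there is no slack left:
    all of [N[x] :&: S] must defend [x] ([defense_saturated]).

    Saturation is incompatible with 4-cycles.  By connectedness some edge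
    [x z] leaves [S].  Complete it to a 4-cycle [x z v w].  Then [w] lies in
    [S], since [z] is the only neighbour of [x] outside [S]; hence [w] defends
    [x].  If [v] is outside [S], then [w] is a border vertex and defends
    itself; otherwise [v] is a border vertex because of [z], and [w] defends
    [v].  Either way [w] defends two distinct vertices
    ([ultra_secure_eq_setT]).

    The grid has maximum degree at most 4, is connected, and every edge of a
    product of two graphs without isolated vertices lies on a 4-cycle: move
    the edge sideways in the other factor. *)

Section Secure.
Variable G : sgraph.
Implicit Types (x y z : G) (S : {set G}) (D : {ffun G -> G}).

Lemma mem_bord S x z : x \in S -> z \notin S -> adj x z -> x \in bord S.
Proof.
move=> xS zS xz; rewrite inE xS; apply/set0Pn; exists z.
by rewrite !inE zS xz orbT.
Qed.

(** The worst attack on [x]: every vertex that can attack [x] does. *)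
Lemma defense_lower_bound k S D x : is_ultra_defense k S D -> x \in bord S ->
  k + #|cl_nbh x :\: S| <= #|defenders S D x|.
Proof.
case/andP=> _ /forallP defD xB.
pose target y := if adj x y then x
  else odflt x [pick z | (z \in bord S) && adj y z].
pose A := finfun target.
have attA : is_attack S A.
  apply/forall_inP => y; rewrite inE => /andP[yS /bigcupP[z zS]].
  rewrite inE ffunE /target => /orP[/eqP yz | zy].
    by rewrite yz zS in yS.
  have [xy | _] := ifP; first by rewrite xB adj_sym.
  case: pickP => [u //|/(_ z)].
  by rewrite (mem_bord zS yS zy) adj_sym zy.
have /forall_inP/(_ x xB) := implyP (defD A) attA.
apply: leq_trans; rewrite leq_add2l; apply/subset_leq_card/subsetP => y.
have xS : x \in S by move: xB; rewrite inE => /andP[].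
rewrite !inE => /andP[yS xy]; rewrite yS /=.
have {}xy : adj x y by case/predU1P: xy => // yx; rewrite yx xS in yS.
rewrite ffunE /target xy eqxx andbT.
by apply/bigcupP; exists x; rewrite // inE xy orbT.
Qed.

Lemma defenders_sub k S D x : is_ultra_defense k S D ->
  defenders S D x \subset cl_nbh x :&: S.
Proof.
case/andP=> /forall_inP defD _; apply/subsetP => y; rewrite inE.
case/andP=> yd /eqP yx; have /andP[_] := defD y yd.
move: yd; rewrite yx !inE eq_sym => /andP[_ ->].
by rewrite (adj_sym y) andbT.
Qed.

(** The two bounds on the number of defenders leave room for a single
    neighbour outside [S], and are then both equalities. *)
Lemma defense_saturated k S D x :
    #|[set y | adj x y]| <= k.+1 -> is_ultra_defense k S D -> x \in bord S ->
  #|cl_nbh x :\: S| = 1 /\ {in cl_nbh x :&: S, forall y, D y = x}.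
Proof.
move=> degx defD xB; have lo := defense_lower_bound defD xB.
have sub := defenders_sub x defD; have up := subset_leq_card sub.
have nbh_card : #|cl_nbh x :&: S| + #|cl_nbh x :\: S| <= k.+2.
  rewrite cardsID; have -> : cl_nbh x = x |: [set y | adj x y].
    by apply/setP => y; rewrite !inE.
  by rewrite cardsU1 !inE adj_irrefl.
have out_gt0 : 0 < #|cl_nbh x :\: S|.
  by rewrite card_gt0; move: xB; rewrite inE => /andP[].
have out1 : #|cl_nbh x :\: S| = 1.
  apply/eqP; rewrite eqn_leq out_gt0 andbT.
  have := leq_trans (leq_add (leq_trans lo up) (leqnn _)) nbh_card.
  by rewrite -addnA -[k.+2]addn2 leq_add2l addnn -[2]/(1.*2) leq_double.
split=> // y; suff <- : defenders S D x = cl_nbh x :&: S.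
  by rewrite inE => /andP[_ /eqP].
apply/eqP; rewrite eqEcard sub; apply: leq_trans lo.
by rewrite out1; move: nbh_card; rewrite out1 !addn1 ltnS.
Qed.

Lemma edge_leaving S : (forall x y, connect (@adj G) x y) ->
  S != set0 -> S != [set: G] -> exists x z, [/\ x \in S, z \notin S & adj x z].
Proof.
move=> conG /set0Pn[a aS]; rewrite -subTset => /subsetPn[b _ bS].
case: (pickP [pred e : G * G | [&& e.1 \in S, e.2 \notin S & adj e.1 e.2]]).
  by case=> x z /and3P[xS zS xz]; exists x, z.
move=> noedge; suff clS : closed (@adj G) (mem S).
  by move: bS; rewrite -(closed_connect clS (conG a b)) aS.
apply: (intro_closed (sym_connect_sym (@adj_sym G))) => x y xy xS.
by have := noedge (x, y); rewrite /= xS xy andbT => /negbFE.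
Qed.

(** The vertex [w] of a 4-cycle [x z v w] through an edge [x z] leaving [S]
    would have to defend [x] together with either itself or [v]. *)
Lemma ultra_secure_eq_setT k S :
    (forall x, #|[set y | adj x y]| <= k.+1) ->
    (forall x y, connect (@adj G) x y) ->
    (forall x z, adj x z -> exists w v,
       [/\ adj x w, adj w v, adj v z, w != z & v != x]) ->
  ultra_secure k S -> S = [set: G].
Proof.
move=> deg conG sqG /andP[S0 /orP[/eqP // | /existsP[D defD]]].
apply: contraTeq isT => ST.
have [x [z [xS zS xz]]] := edge_leaving conG S0 ST.
have [w [v [xw wv vz wz vx]]] := sqG x z xz.
have sat y := @defense_saturated k S D y (deg y) defD.
have [out1 Dx] := sat x (mem_bord xS zS xz).
have wS : w \in S.
  apply: contraNT wz => wS.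
  have := eq_leq out1; move/card_le1_eqP; move/(_ w z) => -> //.
    by rewrite !inE wS xw orbT.
  by rewrite !inE zS xz orbT.
have Dw : D w = x by apply: Dx; rewrite !inE xw orbT wS.
have [vS | vS] := boolP (v \in S).
  have [_ Dv] := sat v (mem_bord vS zS vz).
  have Dwv : D w = v by apply: Dv; rewrite !inE adj_sym wv orbT wS.
  by rewrite -Dw Dwv eqxx in vx.
have [_ /(_ w)] := sat w (mem_bord wS vS wv).
rewrite !inE eqxx wS Dw => /(_ isT) xw_eq.
by rewrite xw_eq adj_irrefl in xw.
Qed.

Lemma ultra_security_number_full k : 0 < #|G| ->
    (forall S, ultra_secure k S -> S = [set: G]) ->
  ultra_security_number G k = #|G|.
Proof.
move=> G0 full; rewrite /ultra_security_number.
case: arg_minnP => [|S /full -> _]; first exact: ultra_secure_setT.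
by rewrite cardsT.
Qed.

End Secure.

Section Product.
Variables G1 G2 : sgraph.
Local Notation H := (cart_prod G1 G2).

Lemma adj_cart_prod (p q : H) : adj p q =
  ((p.1 == q.1) && adj p.2 q.2) || ((p.2 == q.2) && adj p.1 q.1).
Proof. by []. Qed.

Lemma cart_prod_degree d1 d2 (p : H) :
    #|[set y | adj p.1 y]| <= d1 -> #|[set y | adj p.2 y]| <= d2 ->
  #|[set q : H | adj p q]| <= d1 + d2.
Proof.
move=> deg1 deg2; pose N1 := [set y | adj p.1 y]; pose N2 := [set y | adj p.2 y].
have sub : [set q : H | adj p q] \subset
    setX N1 [set p.2] :|: setX [set p.1] N2.
  apply/subsetP => -[a b]; rewrite !inE adj_cart_prod /=.
  by rewrite (eq_sym a) (eq_sym b) orbC (andbC (adj _ _)).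
apply: leq_trans (subset_leq_card sub) _.
apply: leq_trans (leq_card_setU _ _) _.
by rewrite !cardsX !cards1 muln1 mul1n leq_add.
Qed.

Lemma cart_prod_connect :
    (forall x y, connect (@adj G1) x y) -> (forall x y, connect (@adj G2) x y) ->
  forall p q : H, connect (@adj H) p q.
Proof.
move=> con1 con2 [a b] [a' b']; apply: (@connect_trans _ _ (a', b)).
  have /connectP[s] := con1 a a'; elim: s a => [|c s IHs] a /=.
    by move=> _ ->.
  case/andP=> ac sP la; apply: connect_trans (connect1 _) (IHs c sP la).
  by rewrite adj_cart_prod /= eqxx ac orbT.
have /connectP[s] := con2 b b'; elim: s b => [|c s IHs] b /=.
  by move=> _ ->.
case/andP=> bc sP lb; apply: connect_trans (connect1 _) (IHs c sP lb).
by rewrite adj_cart_prod /= eqxx bc.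
Qed.

Lemma cart_prod_square :
    (forall x : G1, exists y, adj x y) -> (forall x : G2, exists y, adj x y) ->
  forall p q : H, adj p q -> exists w v : H,
    [/\ adj p w, adj w v, adj v q, w != q & v != p].
Proof.
have adj_neq (G : sgraph) (x y : G) : adj x y -> (x == y) = false.
  by move=> xy; apply: contraTF xy => /eqP->; rewrite adj_irrefl.
move=> nb1 nb2 [a b] [c d]; rewrite adj_cart_prod /=.
case/orP=> /andP[/eqP <-].
  move=> bd; have [e ae] := nb1 a; exists (e, b), (e, d).
  rewrite /cart_adj !xpair_eqE /= !eqxx ae bd (adj_sym e a) ae orbT.
  by rewrite ![e == a]eq_sym (adj_neq _ _ _ ae).
move=> ac; have [e be] := nb2 b; exists (a, e), (c, e).
rewrite /cart_adj !xpair_eqE /= !eqxx be ac (adj_sym e b) be !orbT.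
by rewrite ![e == b]eq_sym (adj_neq _ _ _ be) !andbF.
Qed.

End Product.

Section Path.
Variable m : nat.

Lemma path_graph_degree (x : path_graph m) : #|[set y | adj x y]| <= 2.
Proof.
case: m x => [[]//|m'] x.
have sub : [set y | adj x y] \subset
    [set (inord x.+1 : 'I_m'.+1); (inord x.-1 : 'I_m'.+1)].
  apply/subsetP => y; rewrite !inE => /orP[] /eqP e.
    by rewrite e inord_val eqxx.
  by rewrite -e /= inord_val eqxx orbT.
by apply: leq_trans (subset_leq_card sub) _; rewrite cards2; case: (_ != _).
Qed.

Lemma path_graph_connect (x y : path_graph m) : connect (@adj (path_graph m)) x y.
Proof.
have con0 i (lt0m : 0 < m) (ltim : i < m) : connect (@adj (path_graph m))
    (Ordinal lt0m) (Ordinal ltim).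
  elim: i ltim => [|i IHi] ltim; first by rewrite (bool_irrelevance ltim lt0m).
  apply: connect_trans (IHi (ltnW ltim)) (connect1 _).
  by rewrite /adj /= /path_adj eqxx.
have lt0m : 0 < m by apply: leq_ltn_trans (ltn_ord x).
apply: (@connect_trans _ _ (Ordinal lt0m)).
  rewrite (sym_connect_sym (@adj_sym (path_graph m))).
  by case: x => i ltim; apply: con0.
by case: y => i ltim; apply: con0.
Qed.

Lemma path_graph_neighbor (x : path_graph m) : 1 < m -> exists y, adj x y.
Proof.
case: x => -[|i] ltim lt1m; first by exists (Ordinal lt1m).
by exists (Ordinal (ltnW ltim)); rewrite /adj /= /path_adj /= eqxx orbT.
Qed.

End Path.

Theorem theorem4p12 (m n : nat) (hm : 5 <= m) (hn : 5 <= n) :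
  ultra_security_number (cart_prod (path_graph m) (path_graph n)) 3 = m * n.
Proof.
have card_grid : #|cart_prod (path_graph m) (path_graph n)| = m * n.
  by rewrite card_prod !card_ord.
have lt1m : 1 < m by apply: leq_trans hm.
have lt1n : 1 < n by apply: leq_trans hn.
rewrite -card_grid; apply: ultra_security_number_full => [|S].
  by rewrite card_grid muln_gt0 (ltnW lt1m) (ltnW lt1n).
apply: ultra_secure_eq_setT.
- by move=> p; apply: (@cart_prod_degree _ _ 2 2); apply: path_graph_degree.
- by apply: cart_prod_connect; apply: path_graph_connect.
- by apply: cart_prod_square => x; apply: path_graph_neighbor.
Qed.
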